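(* Let $q$ be a prime power and let $r,n,h$ be positive integers such that $h\le r-1$, $h+1$ divides $rn$ and $n\geq h+3$. Let $U$ be an $\frac{rn}{h+1}$-dimensional $\mathbb{F}_q$-subspace of an $r$-dimensional $\mathbb{F}_{q^n}$-vector space $V$. Then $U$ is an $h$-scattered $\mathbb{F}_q$-subspace of $V$ if and only if $$\dim_{\mathbb{F}_q}(H\cap U)\leq\frac{rn}{h+1}-n+h$$ for every $(r-1)$-dimensional $\mathbb{F}_{q^n}$-subspace $H$ of $V$.
   Context: Let $V$ be an $r$-dimensional $\mathbb{F}_{q^n}$-vector space and $h\le r-1$ a positive integer. An $\mathbb{F}_q$-subspace $U$ of $V$ is $h$-scattered if $\langle U\rangle_{\mathbb{F}_{q^n}}=V$ and $\dim_{\mathbb{F}_q}(U\cap H)\le h$ for every $h$-dimensional $\mathbb{F}_{q^n}$-subspace $H$ of $V$. *)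

(* Defs.v *)
From HB Require Import structures.
From mathcomp Require Import all_boot all_order all_algebra all_field.

Set Implicit Arguments.
Unset Strict Implicit.
Unset Printing Implicit Defensive.

Import GRing.Theory.
Local Open Scope ring_scope.

(* Restriction of scalars: an L-vector space V seen over a subfield F of L.   *)
(* This generalizes baseFieldType of fieldext.v from field extensions to      *)
(* vector spaces; V and resScalars V are convertible but carry different      *)
(* module structures, so (a *: u) may need a type annotation on u.            *)
Section ResScalars.

Variables (F : fieldType) (L : fieldExtType F) (V : vectType L).

Definition resScalars : Type := V.
Local Notation V0 := resScalars.

HB.instance Definition _ := GRing.Zmodule.on V0.

Definition resScalars_scale (a : F) (u : V0) : V0 := in_alg L a *: (u : V).
Local Infix "*F:" := resScalars_scale (at level 40).

Fact resScalars_scaleA a b u : a *F: (b *F: u) = (a * b) *F: u.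
Proof. by rewrite [_ *F: _]scalerA -rmorphM. Qed.

Fact resScalars_scale1 u : 1 *F: u = u.
Proof. by rewrite /(1 *F: u) rmorph1 scale1r. Qed.

Fact resScalars_scaleDr a u v : a *F: (u + v) = a *F: u + a *F: v.
Proof. exact: scalerDr. Qed.

Fact resScalars_scaleDl v a b : (a + b) *F: v = a *F: v + b *F: v.
Proof. by rewrite -scalerDl -rmorphD. Qed.

HB.instance Definition _ := GRing.Zmodule_isLmodule.Build _ V0
  resScalars_scaleA resScalars_scale1 resScalars_scaleDr resScalars_scaleDl.

Lemma resScalars_scaleE a (u : V) : a *: (u : V0) = a%:A *: u.
Proof. by []. Qed.

Let n := \dim {:L}.
Let bL : n.-tuple L := vbasis {:L}.
Let coordL (x : L) := (coord_vbasis (memvf x)).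

Fact resScalars_vectMixin : Lmodule_hasFinDim F V0.
Proof.
pose bV := vbasis {:V}; set m := \dim {:V} in bV.
pose v2r (x : V0) := mxvec (\matrix_(i, j) coord bL j (coord bV i x)).
have v2r_lin: linear v2r.
  move=> a x y; rewrite -linearP; congr mxvec; apply/matrixP=> i j.
  by rewrite !mxE linearP /= mulr_algl linearP.
pose r2v r : V := \sum_(i < m) (\sum_(j < n) vec_mx r i j *: bL`_j) *: bV`_i.
have v2rK: cancel v2r r2v.
  move=> x; transitivity (\sum_(i < m) coord bV i x *: bV`_i); last first.
    by rewrite -coord_vbasis ?memvf.
  apply: eq_bigr => i _; rewrite mxvecK; congr (_ *: _ : V).
  by rewrite (coordL (coord bV i x)); apply: eq_bigr => j _; rewrite mxE.
exists (m * n)%N, v2r => //; exists r2v => // r.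
apply: (canLR vec_mxK); apply/matrixP=> i j; rewrite mxE.
by rewrite !coord_sum_free ?(basis_free (vbasisP _)).
Qed.

HB.instance Definition _ := resScalars_vectMixin.

Let F0ZEZ a x v : a *: ((x *: v : V) : V0) = (a *: x) *: v.
Proof. by rewrite [a *: _]scalerA -scalerAl mul1r. Qed.

Implicit Types (U : {vspace V0}) (H : {vspace V}).

Let resVspace_basis H : seq V0 :=
  [seq tnth bL ij.2 *: tnth (vbasis H) ij.1 | ij : 'I_(\dim H) * 'I_n].
(* By mem_resVspace below, resVspace H is H itself, seen over F.              *)
Definition resVspace H : {vspace V0} := <<resVspace_basis H>>%VS.

Lemma mem_resVspace H : resVspace H =i H.
Proof.
move=> y; apply/idP/idP=> [/coord_span->|/coord_vbasis->]; last first.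
  apply: memv_suml => i _; rewrite (coordL (coord _ i (y : V))) scaler_suml -/n.
  apply: memv_suml => j _; rewrite -/bL -F0ZEZ memvZ ?memv_span // -!tnth_nth.
  by apply/imageP; exists (i, j).
apply: memv_suml => k _; rewrite nth_image; case: (enum_val k) => i j /=.
by rewrite F0ZEZ memvZ ?vbasis_mem ?mem_tnth.
Qed.

Lemma dim_resVspace H : \dim (resVspace H) = (\dim H * n)%N.
Proof.
pose bV0 := resVspace_basis H; set m := \dim H in bV0 *.
suffices /size_basis->: basis_of (resVspace H) bV0.
  by rewrite card_prod !card_ord.
rewrite /basis_of eqxx.
apply/freeP=> s sb0 k; rewrite -(enum_valK k); case/enum_val: k => i j.
have free_baseP := freeP (basis_free (vbasisP _)).
move: j; apply: (free_baseP _ _ fullv); move: i; apply: (free_baseP _ _ H).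
transitivity (\sum_i \sum_j s (enum_rank (i, j)) *: bV0`_(enum_rank (i, j))).
  apply: eq_bigr => i _; rewrite scaler_suml; apply: eq_bigr => j _.
  by rewrite -F0ZEZ nth_image enum_rankK -!tnth_nth.
rewrite pair_bigA (reindex _ (onW_bij _ (enum_val_bij _))); apply: etrans sb0.
by apply: eq_bigr => k _; rewrite -{5 6}[k](enum_valK k); case/enum_val: k.
Qed.

(* The L-span of an F-subspace; sub_extSpan shows that it does not depend on  *)
(* the chosen F-basis.                                                        *)
Definition extSpan U : {vspace V} := <<(vbasis U : seq V)>>%VS.

Lemma sub_extSpan U H : (extSpan U <= H)%VS <-> {subset U <= H}.
Proof.
split=> [sUH u Uu | sUH]; last first.
  by apply/span_subvP=> u Uu; apply: sUH; exact: (@vbasis_mem _ V0 u U).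
apply: (subvP sUH); rewrite (coord_vbasis Uu); apply: memv_suml => i _.
by rewrite resScalars_scaleE memvZ // memv_span // mem_nth ?size_tuple.
Qed.

Definition scattered (h : nat) U : Prop :=
  extSpan U = fullv /\
  forall H, \dim H = h -> (\dim (U :&: resVspace H) <= h)%N.

End ResScalars.

(* Main.v *)
Require Import Defs.
From HB Require Import structures.
From mathcomp Require Import all_boot all_order all_algebra all_field.
From mathcomp Require Import zify.

Set Implicit Arguments.
Unset Strict Implicit.
Unset Printing Implicit Defensive.

Local Open Scope ring_scope.
Import GRing.Theory.

(** Both properties of U are read off the combinations
    a_0 u_0 + ... + a_h u_h, where a_0, ..., a_h are F-independent scalars
    of L and the u_i range over U.  For fixed a, let S_a denote the image in V
    of the map (u_0, ..., u_h) |-> a_0 u_0 + ... + a_h u_h from U^(h+1).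
    The hypothesis dim_F U = r n / (h + 1) says precisely that source and
    target have the same F-dimension r n, so this map is injective if and only
    if S_a = V ([tensor_injective_combv]).  The two sides of the theorem are
    injectivity for all a, and surjectivity for all a.

    Injectivity is scatteredness.  U meets every h-dimensional L-subspace in
    F-dimension at most h exactly when F-independent u_0, ..., u_h in U are
    always L-independent ([scattered_tensor_injective]).  This says that no
    nonzero tensor of rank at most h + 1 in the F-space L (x) U is killed by
    scalar multiplication, the tensor being written with independent vectors
    of U; injectivity for all a says the same, the tensor being written with
    independent scalars ([tensor_injective_flip]).

    Surjectivity is the hyperplane condition.  S_a is a proper subspace exactly
    when some nonzero F-linear form g on V satisfies g (a_i u) = 0 for all i
    and all u in U.  The form g determines the L-subspace H of those v with
    g (x v) = 0 for all x in L, which is an L-hyperplane since F-linear forms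
    on L form a space of dimension n.  The pairing (x, u) |-> g (x u) of L with
    U has right kernel U :&: H, and it vanishes on all a_i if and only if its
    left kernel contains the a_i.  As the left and right ranks of a pairing
    agree, h + 1 independent a_i of this kind exist exactly when the
    codimension of U :&: H in U is at most n - h - 1
    ([combv_full_hyperplane], [hyperplane_combv_full]).

    In the language of rank-metric codes, this is the statement that a linear
    code is maximum rank distance if and only if its dual code is. *)

(** * Subspaces of prescribed dimension *)

Section Subspaces.

Variables (K : fieldType) (X : vectType K).
Implicit Types (A B W : {vspace X}).

Lemma vspace_between A B m : (A <= B)%VS -> (\dim A <= m <= \dim B)%N ->
  exists W, [/\ (A <= W)%VS, (W <= B)%VS & \dim W = m].
Proof.
move=> sAB /andP[leAm lemB].
pose s := vbasis (B :\: A); pose t := take (m - \dim A) s.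
have sz_t : size t = (m - \dim A)%N.
  rewrite size_take size_tuple; have := dimv_cap_compl B A.
  rewrite (capv_idPr sAB) => e; case: ltnP => // h.
  by apply/eqP; rewrite eqn_leq h /= leq_subLR e.
have free_t : free t.
  apply: (@catl_free _ _ (drop (m - \dim A) s)).
  by rewrite cat_take_drop; exact: basis_free (vbasisP _).
have st : (<<t>> <= B :\: A)%VS.
  by apply/span_subvP=> x /mem_take; exact: vbasis_mem.
exists (A + <<t>>)%VS; split; first exact: addvSl.
  by rewrite subv_add sAB (subv_trans st) ?diffvSl.
rewrite dimv_disjoint_sum ?(eqP free_t) ?sz_t ?subnKC //.
by apply/eqP; rewrite -subv0 -(capv_diff B A) capvC; exact: capvS.
Qed.

Lemma free_tuple_in B m : (m <= \dim B)%N ->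
  exists2 a : m.-tuple X, free a & forall i, tnth a i \in B.
Proof.
move=> lemB; have [|W [_ sWB <-]] := @vspace_between 0%VS B m (sub0v _).
  by rewrite dimv0.
exists (vbasis W) => [|i]; first exact: basis_free (vbasisP W).
by apply: (subvP sWB); apply: vbasis_mem; exact: mem_tnth.
Qed.

End Subspaces.

(** * Bilinear maps, annihilators, and tensors of bounded rank *)

Section Bilinear.

Variables (K : fieldType).

Lemma linfunE (X Y : vectType K) (f : X -> Y) : linear f -> linfun f =1 f.
Proof.
move=> lin_f x.
pose g : {linear X -> Y} :=
  HB.pack f (GRing.isLinear.Build _ _ _ _ f lin_f).
exact: (lfunE g).
Qed.

Definition bilfun (X Y Z : vectType K) (B : X -> Y -> Z) :
  'Hom(X, 'Hom(Y, Z)) := linfun (fun x => linfun (B x)).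

Lemma bilfunE (X Y Z : vectType K) (B : X -> Y -> Z) :
  (forall x, linear (B x)) -> (forall y, linear (B^~ y)) ->
  forall x y, bilfun B x y = B x y.
Proof.
move=> linr linl x y; rewrite /bilfun linfunE ?linfunE // => c u v.
by apply/lfunP=> z; rewrite add_lfunE scale_lfunE !linfunE // (linl z).
Qed.

Definition flip (X Y Z : vectType K) (B : 'Hom(X, 'Hom(Y, Z))) :=
  bilfun (fun y x => B x y).

Lemma flipE (X Y Z : vectType K) (B : 'Hom(X, 'Hom(Y, Z))) y x :
  flip B y x = B x y.
Proof.
rewrite /flip bilfunE // => z c u v; last by rewrite linearP.
by rewrite linearP add_lfunE scale_lfunE.
Qed.

Lemma flipK (X Y Z : vectType K) (B : 'Hom(X, 'Hom(Y, Z))) :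
  flip (flip B) = B.
Proof. by apply/lfunP=> x; apply/lfunP=> y; rewrite !flipE. Qed.

(** Written on a basis of A, so that its codimension is visibly at most the
    dimension of A; [annvP] is the description without a basis. *)
Definition annv (X Y : vectType K) (B : 'Hom(X, 'Hom(Y, K^o)))
  (A : {vspace X}) : {vspace Y} :=
  (\bigcap_(i < \dim A) lker (B (tnth (vbasis A) i)))%VS.

Lemma annvP (X Y : vectType K) (B : 'Hom(X, 'Hom(Y, K^o)))
  (A : {vspace X}) y :
  reflect (forall x, x \in A -> B x y = 0) (y \in annv B A).
Proof.
rewrite memvE; apply: (iffP subv_bigcapP) => [H x Ax | H i _].
  rewrite (coord_vbasis Ax) linear_sum sum_lfunE big1 // => i _.
  have := H i isT; rewrite -memvE memv_ker linearZ scale_lfunE -tnth_nth.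
  by move/eqP->; rewrite scaler0.
by rewrite -memvE memv_ker H // vbasis_mem ?mem_tnth.
Qed.

(** Each of the [\dim A] linear equations that define the annihilator lowers
    the dimension by at most one. *)
Lemma dim_annv (X Y : vectType K) (B : 'Hom(X, 'Hom(Y, K^o)))
  (A : {vspace X}) (D : {vspace Y}) :
  (\dim D <= \dim (D :&: annv B A) + \dim A)%N.
Proof.
rewrite /annv -[X in (_ <= _ + X)%N]card_ord -sum1_card.
(* The intersection and the number of equations grow together; D must stay
   general, as the second family of equations acts on what the first leaves. *)
elim/big_ind2: _ D => [|C m C' m' leC leC'|i _] D.
- by rewrite capvf addn0.
- rewrite capvA (leq_trans (leC D)) // addnC [leqRHS]addnCA leq_add2l addnC.
  by rewrite addnC leC'.
rewrite -(limg_ker_dim (B (tnth (vbasis A) i)) D) leq_add2l.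
by rewrite (leq_trans (dimvS (subvf _))) // dimvf.
Qed.

(** The evaluation pairing of X with its dual, which has the same dimension
    as X, gives S a nonzero annihilator. *)
Lemma ex_functional (X : vectType K) (S : {vspace X}) : S != fullv ->
  exists2 g : 'Hom(X, K^o), g != 0 & forall x, x \in S -> g x = 0.
Proof.
move=> neS; pose B : 'Hom(X, 'Hom('Hom(X, K^o), K^o)) := flip \1%VF.
have := dim_annv B S fullv; rewrite capfv => le_ann.
have : vpick (annv B S) != 0.
  rewrite vpick0 -dimv_eq0; apply: contra neS => /eqP e0.
  move: le_ann; rewrite e0 eqEdim subvf /= !dimvf.
  by rewrite /dim /= muln1.
exists (vpick (annv B S)) => // x Sx.
by have /annvP/(_ x Sx) := memv_pick (annv B S); rewrite flipE id_lfunE.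
Qed.

(** When A has dimension at least m, this says that the linear map from
    A (x) D to Z induced by B kills no nonzero tensor of rank at most m: such
    a tensor is a sum of m terms a_i (x) y_i with independent left factors. *)
Definition tensor_injective (X Y Z : vectType K) (B : 'Hom(X, 'Hom(Y, Z))) m
    (A : {vspace X}) (D : {vspace Y}) :=
  forall (a : m.-tuple X) (y : 'I_m -> Y), free a ->
    (forall i, tnth a i \in A) -> (forall i, y i \in D) ->
    \sum_i B (tnth a i) (y i) = 0 -> forall i, y i = 0.

(** The rank of a tensor does not depend on which factor carries the
    independent family: expand the arbitrary factors x_i on m independent
    vectors of A and collect the terms. *)
Lemma tensor_injective_flip (X Y Z : vectType K)
  (B : 'Hom(X, 'Hom(Y, Z))) m (A : {vspace X}) (D : {vspace Y}) :
  (m <= \dim A)%N -> tensor_injective B m A D ->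
  tensor_injective (flip B) m D A.
Proof.
move=> lemA injB y x free_y yD xA sum0.
have sxA : (<<[seq x i | i : 'I_m]>> <= A)%VS.
  by apply/span_subvP=> _ /mapP[i _ ->].
have [|W [sxW sWA dimW]] := @vspace_between _ _ _ A m sxA.
  by rewrite lemA andbT (leq_trans (dim_span _)) // size_map size_enum_ord.
have xW i : x i \in W.
  by apply: (subvP sxW); apply: memv_span; apply: map_f; rewrite mem_enum.
subst m.
pose a := vbasis W; pose c i j := coord a j (x i).
have xE i : x i = \sum_j c i j *: tnth a j.
  by rewrite {1}(coord_vbasis (xW i)); apply: eq_bigr => j _; rewrite -tnth_nth.
have /injB inj_a : free a by exact: basis_free (vbasisP W).
have c0 : forall j, \sum_i c i j *: tnth y i = 0.
  apply: inj_a => [j|j|].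
  - by apply: (subvP sWA); rewrite vbasis_mem ?mem_tnth.
  - by apply: memv_suml => i _; rewrite memvZ.
  rewrite -{}[RHS]sum0.
  under eq_bigr => j _ do rewrite linear_sum.
  rewrite exchange_big; apply: eq_bigr => i _.
  rewrite flipE xE linear_sum sum_lfunE; apply: eq_bigr => j _.
  by rewrite !linearZ scale_lfunE.
move=> i; rewrite xE big1 // => j _.
have /freeP free_y' := free_y.
rewrite (free_y' (c^~ j)) ?scale0r // -[RHS](c0 j).
by apply: eq_bigr => k _; rewrite -tnth_nth.
Qed.

End Bilinear.

(** * Scattered subspaces and scalar multiplication *)

Section ScalarMultiplication.

Variables (F : fieldType) (L : fieldExtType F) (V : vectType L).
Local Notation V0 := (resScalars V).
Implicit Types (U K : {vspace V0}) (H : {vspace V}).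

Definition scal : 'Hom(L, 'End(V0)) :=
  bilfun (fun (x : L) (v : V0) => (x *: (v : V) : V0)).

Lemma scalE (x : L) (v : V0) : scal x v = x *: (v : V).
Proof.
rewrite /scal bilfunE // => {x v}.
  move=> x c u v; rewrite resScalars_scaleE scalerDr !resScalars_scaleE.
  by rewrite !scalerA mulrC.
move=> v c x y; rewrite resScalars_scaleE scalerDl scalerA.
by rewrite -[in RHS]scalerAl mul1r.
Qed.

Lemma dim_resScalars : \dim {:V0} = (\dim {:V} * \dim {:L})%N.
Proof.
rewrite -dim_resVspace; congr dimv; apply/vspaceP=> v.
by rewrite [LHS]memvf mem_resVspace [RHS]memvf.
Qed.

Lemma resVspace_full_inj H : resVspace H = fullv -> H = fullv.
Proof.
by move=> e; apply/vspaceP=> v; rewrite -mem_resVspace e [LHS]memvf [RHS]memvf.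
Qed.

Lemma resVspace_extSpan K :
  (forall x v, v \in K -> scal x v \in K) -> resVspace (extSpan K) = K.
Proof.
move=> closedK; apply/vspaceP=> v; rewrite mem_resVspace.
apply/idP/idP=> [/coord_span-> | ]; last first.
  by move: v; exact: (sub_extSpan K (extSpan K)).1 (subvv _).
apply: (@memv_suml _ V0) => i _; rewrite -scalE closedK //.
by apply: (@vbasis_mem _ V0); rewrite mem_nth ?size_tuple.
Qed.

Lemma free_flip_scal m (u : m.-tuple V0) :
  free (u : m.-tuple V) <->
  forall x : 'I_m -> L,
    \sum_i flip scal (tnth u i) (x i) = 0 -> forall i, x i = 0.
Proof.
have sumE (x : 'I_m -> L) :
  \sum_i flip scal (tnth u i) (x i) = \sum_i x i *: (u : m.-tuple V)`_i.
  by apply: eq_bigr => i _; rewrite flipE scalE (tnth_nth 0).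
split=> [/freeP free_u x | free_u]; first by rewrite sumE; exact: free_u.
by apply/freeP=> x; rewrite -sumE; exact: free_u.
Qed.

(** An L-dependent family of h + 1 vectors of U fits in an L-subspace of
    dimension h; if it is F-independent, U meets that subspace in dimension
    more than h, and every such excess arises in this way. *)
Lemma scattered_tensor_injective h U : (h <= \dim {:V})%N ->
  (forall H, \dim H = h -> (\dim (U :&: resVspace H) <= h)%N) <->
  tensor_injective (flip scal) h.+1 U fullv.
Proof.
move=> le_hV; split=> [scatU u x free_u uU _ sum0 | injU H dimH].
  apply: (free_flip_scal u).1 sum0; apply: contraT => nfree_u.
  have [|H [sH _ dimH]] :=
    @vspace_between _ V <<(u : h.+1.-tuple V)>>%VS fullv h (subvf _).
    rewrite le_hV andbT -ltnS ltn_neqAle.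
    move: nfree_u; rewrite /free size_tuple => -> /=.
    by rewrite (leq_trans (dim_span _)) ?size_tuple.
  have := scatU H dimH; rewrite leqNgt => /negP[].
  rewrite -(size_tuple u) -(eqP free_u); apply: dimvS.
  apply/span_subvP=> v uv; rewrite memv_cap mem_resVspace.
  have /tnthP[i ->] := uv; rewrite uU /=; apply: (subvP sH).
  by apply: memv_span; exact: mem_tnth.
rewrite leqNgt; apply/negP=> /free_tuple_in[u free_u uUH].
have uU i : tnth u i \in U by have := uUH i; rewrite memv_cap => /andP[].
have : free (u : h.+1.-tuple V).
  by apply/free_flip_scal => x; apply: injU => // i; exact: memvf.
rewrite /free size_tuple => /eqP dim_u.
suff : (\dim <<(u : h.+1.-tuple V)>> <= \dim H)%N by rewrite dim_u dimH ltnn.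
apply: dimvS; apply/span_subvP=> _ /tnthP[i ->].
by have := uUH i; rewrite memv_cap mem_resVspace => /andP[].
Qed.

Definition combv m (a : m.-tuple L) U : {vspace V0} :=
  (\sum_(i < m) scal (tnth a i) @: U)%VS.

(** With equal dimensions, the sum of the m copies a_i U of U is direct if and
    only if it fills the whole space. *)
Lemma tensor_injective_combv m U : (m * \dim U = \dim {:V0})%N ->
  tensor_injective scal m fullv U <->
  forall a : m.-tuple L, free a -> combv a U = fullv.
Proof.
move=> dimU.
have dim_scal (a : m.-tuple L) i : free a ->
  \dim (scal (tnth a i) @: U) = \dim U /\ lker (scal (tnth a i)) == 0%VS.
  move=> /free_not0/(_ (mem_tnth i a)) a_neq0.
  have ker0 : lker (scal (tnth a i)) == 0%VS.
    apply/eqP/vspaceP=> v; rewrite memv_ker memv0 scalE.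
    by rewrite (@scaler_eq0 _ V) (negPf a_neq0).
  by rewrite limg_dim_eq // (eqP ker0) capv0.
have directP (a : m.-tuple L) : free a ->
  directv (\sum_(i < m) scal (tnth a i) @: U) = (combv a U == fullv).
  move=> free_a.
  have sumE : (\sum_(i < m) \dim (scal (tnth a i) @: U) = \dim {:V0})%N.
    under eq_bigr => i _ do rewrite (dim_scal a i free_a).1.
    by rewrite sum_nat_const card_ord.
  by rewrite directvE /= sumE /combv eqEdim subvf eqn_leq (dimvS (subvf _)).
split=> [injU a free_a | fullU a y free_a _ yU sum0 i].
  apply/eqP; rewrite -directP //.
  apply/directv_sum_independent=> us us_in sum0 i _.
  have /fin_all_exists2[y yU usE] (j : 'I_m) :
    exists2 y, y \in U & us j = scal (tnth a j) y.
    by have /memv_imgP[y Uy ->] := us_in j isT; exists y.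
  have y0 : forall j, y j = 0.
    apply: (injU a) => // [j|]; first exact: memvf.
    by rewrite -[RHS]sum0; apply: eq_bigr => j _; rewrite usE.
  by rewrite usE y0 linear0.
have := fullU a free_a.
move/eqP; rewrite -directP // => /directv_sum_independent indep.
have := indep (fun j => scal (tnth a j) (y j))
  (fun j _ => memv_img _ (yU j)) sum0 i isT.
move/eqP; rewrite -memv_ker (eqP (dim_scal a i free_a).2) memv0.
by move/eqP.
Qed.

Lemma extSpan_combv m (a : m.-tuple L) U :
  combv a U = fullv -> extSpan U = fullv.
Proof.
move=> fullU; apply/vspaceP=> v; rewrite memvf -mem_resVspace.
have : (v : V0) \in combv a U by rewrite fullU memvf.
apply: subvP; apply/subv_sumP=> i _; apply/subvP=> _ /memv_imgP[u Uu ->].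
rewrite scalE mem_resVspace; apply: memvZ.
exact: (sub_extSpan U (extSpan U)).1 (subvv _) u Uu.
Qed.

(** * Hyperplane intersections *)

Definition gscal (g : 'Hom(V0, F^o)) : 'Hom(L, 'Hom(V0, F^o)) :=
  bilfun (fun x v => g (scal x v)).

Lemma gscalE g x v : gscal g x v = g (scal x v).
Proof.
rewrite /gscal bilfunE // => z c u w; first by rewrite !linearP.
by rewrite linearP add_lfunE scale_lfunE linearP.
Qed.

(** Were the intersection larger, take a nonzero F-linear form g that vanishes
    on H.  The scalars x with g (x u) = 0 for all u in U are cut out by a
    complement of the intersection in U, hence contain m independent ones, and
    g would vanish on the corresponding combinations. *)
Lemma combv_full_hyperplane m U H :
  (forall a : m.-tuple L, free a -> combv a U = fullv) -> H != fullv ->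
  (\dim (resVspace H :&: U) + \dim {:L} < \dim U + m)%N.
Proof.
move=> fullU neH; rewrite ltnNge; apply/negP=> leU.
have [|g g_neq0 gH] := @ex_functional _ V0 (resVspace H).
  by apply: contra neH => /eqP/resVspace_full_inj->.
pose N := annv (flip (gscal g)) (U :\: resVspace H)%VS.
have [|a free_a aN] := @free_tuple_in _ L N m.
  have := dim_annv (flip (gscal g)) (U :\: resVspace H)%VS fullv.
  rewrite capfv -/N => le_ann; move: leU.
  rewrite -(dimv_cap_compl U (resVspace H)) capvC -addnA leq_add2l.
  by move=> /leq_trans/(_ le_ann); rewrite addnC leq_add2r.
case/eqP: g_neq0; apply/lfunP=> v; rewrite zero_lfunE.
have : v \in combv a U by rewrite fullU ?memvf.
case/memv_sumP=> w w_in ->; rewrite linear_sum big1 // => i _.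
have /memv_imgP[u Uu ->] := w_in i isT.
move: Uu; rewrite -{1}(addv_diff_cap U (resVspace H)).
case/memv_addP=> u1 Uu1 [u2 /memv_capP[_ Hu2] ->].
have Hau2 : scal (tnth a i) u2 \in resVspace H.
  by move: Hu2; rewrite scalE !mem_resVspace; exact: memvZ.
rewrite linearD linearD /= (gH _ Hau2) addr0.
by have /annvP/(_ u1 Uu1) := aN i; rewrite flipE gscalE.
Qed.

(** A nonzero F-linear form g that vanishes on the combinations yields the
    hyperplane H of all v with g (x v) = 0 for every x in L.  On U it suffices
    to test x in a complement of the span of a, since g (a_i u) = 0; this makes
    U :&: H too large. *)
Lemma hyperplane_combv_full m U : (0 < \dim {:L})%N ->
  (forall H, \dim H = (\dim {:V}).-1 ->
    (\dim (resVspace H :&: U) + \dim {:L} < \dim U + m)%N) ->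
  forall a : m.-tuple L, free a -> combv a U = fullv.
Proof.
move=> L_gt0 hypU a free_a; apply/eqP; apply: contraT.
case/ex_functional=> g g_neq0 g0.
pose K := annv (gscal g) fullv.
have closedK x v : v \in K -> scal x v \in K.
  move/annvP=> Kv; apply/annvP=> y _.
  by rewrite -(Kv (y * x)) ?memvf // !gscalE !scalE scalerA.
have KE := resVspace_extSpan closedK; set H := extSpan K in KE.
have K_neq : K != fullv.
  apply: contra g_neq0 => /eqP Kf; apply/eqP/lfunP=> v; rewrite zero_lfunE.
  have /annvP/(_ 1 (memvf _)) : v \in K by rewrite Kf memvf.
  by rewrite gscalE scalE scale1r.
have dimH : \dim H = (\dim {:V}).-1.
  (* As F-spaces, K has codimension at most \dim {:L} in V, so its
     L-codimension is at most one. *)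
  have := dim_annv (gscal g) fullv fullv; rewrite capfv -/K -KE.
  rewrite dim_resScalars dim_resVspace -mulSnr leq_pmul2r // => leV.
  have : (\dim H < \dim {:V})%N.
    rewrite ltn_neqAle dimvS ?subvf // andbT; apply: contra K_neq => /eqP e.
    by rewrite -KE eqEdim subvf dim_resVspace e dim_resScalars leqnn.
  lia.
have := hypU H dimH; rewrite KE ltnNge => /negP[].
have := dim_annv (gscal g) <<a>>^C%VS U.
rewrite dimv_compl (eqP free_a) size_tuple -(leq_add2r m) => /leq_trans; apply.
have le_mL : (m <= \dim {:L})%N.
  by rewrite -{1}(size_tuple a) -(eqP free_a) dimvS ?subvf.
suff sK : (U :&: annv (gscal g) <<a>>^C <= K :&: U)%VS.
  by rewrite -addnA subnK // leq_add2r dimvS.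
apply/subvP=> u; rewrite !memv_cap => /andP[Uu /annvP ann_u]; rewrite Uu andbT.
apply/annvP=> x _; have := memvf x; rewrite -(addv_complf <<a>>).
case/memv_addP=> y ay [z az ->]; rewrite linearD add_lfunE (ann_u z az) addr0.
rewrite (coord_span ay) linear_sum sum_lfunE big1 // => i _.
rewrite linearZ scale_lfunE gscalE g0 ?scaler0 // -tnth_nth.
by apply: (subvP (sumv_sup i isT (subvv _))); exact: memv_img.
Qed.

End ScalarMultiplication.

(* The F_q-dimension bound uses truncated subtraction, but nothing is         *)
(* truncated: h <= r.-1 and 0 < r give n <= (r * n) %/ h.+1.                  *)
Theorem corollary5p2 (q r n h : nat)
    (F : finFieldType) (L : fieldExtType F) (V : vectType L)
    (U : {vspace resScalars V})
    (cardF : #|F| = q) (dimL : \dim {:L} = n) (dimV : \dim {:V} = r)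
    (r_gt0 : (0 < r)%N) (n_gt0 : (0 < n)%N) (h_gt0 : (0 < h)%N)
    (le_h_r : (h <= r.-1)%N) (h1_dvd_rn : (h.+1 %| r * n)%N)
    (le_h3_n : (h + 3 <= n)%N)
    (dimU : \dim U = ((r * n) %/ h.+1)%N) :
  scattered h U <->
  (forall H : {vspace V}, \dim H = r.-1 ->
     (\dim (resVspace H :&: U) <= (r * n) %/ h.+1 - n + h)%N).
Proof.
have le_hr : (h < r)%N by rewrite -(prednK r_gt0) ltnS.
have le_nU : (n <= \dim U)%N by rewrite dimU leq_divRL // mulnC leq_pmul2r.
have dimU' : (h.+1 * \dim U = \dim {:resScalars V})%N.
  by rewrite dim_resScalars dimL dimV dimU mulnC divnK.
have le_hU : (h.+1 <= \dim U)%N by lia.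
have scatE := @scattered_tensor_injective _ _ V h U.
have injE := tensor_injective_combv dimU'.
rewrite -dimU; split=> [[_ scatU] H dimH | hypU].
  have fullU : forall a : h.+1.-tuple L, free a -> combv a U = fullv.
    apply/injE; rewrite -[@scal _ _ V]flipK.
    apply: tensor_injective_flip => //.
    by apply/scatE; first by rewrite dimV ltnW.
  have neH : H != fullv.
    by apply: contraTneq isT => eH; move: dimH; rewrite eH dimV; lia.
  by have := combv_full_hyperplane fullU neH; rewrite dimL; lia.
have fullU : forall a : h.+1.-tuple L, free a -> combv a U = fullv.
  apply: hyperplane_combv_full => [|H]; first by rewrite dimL.
  by rewrite dimV dimL => /hypU; lia.
split.
  have [|a free_a _] := @free_tuple_in _ L fullv h.+1; first by rewrite dimL; lia.
  exact: extSpan_combv (fullU a free_a).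
apply/scatE; first by rewrite dimV ltnW.
apply: tensor_injective_flip; first by rewrite dimL; lia.
exact/injE.
Qed.
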